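(* Let $D$ be a distortion function and let $Q$ be the probability measure on $\mathcal{B}((0,1))$ corresponding to $D$. If $D$ is convex, then $\mathcal{L}_Q^{\mathrm{Pichler}}\subseteq\mathcal{L}_Q^{\mathrm{Acerbi}}$.
   Context: ''Increasing'' is meant in the weak sense. $(\Omega,\mathcal{F},P)$ is a fixed probability space and $\mathcal{L}^0$ is the set of all real random variables on it. For $X\in\mathcal{L}^0$, $F_X(x):=P[\{X\le x\}]$ and $F_X^\leftarrow:(0,1)\to\mathbb{R}$, $F_X^\leftarrow(u):=\inf\{x\in\mathbb{R}\mid F_X(x)\ge u\}$, is the (lower) quantile function. A distortion function is an increasing, right-continuous function $D:[0,1]\to[0,1]$ with $D(0)=0$ and $\sup_{u\in(0,1)}D(u)=1$ (hence $D(1)=1$). The probability measure $Q$ on $\mathcal{B}((0,1))$ corresponding to $D$ is the unique one with $Q[(0,u]]=D(u)$ for all $u\in(0,1)$. $$\mathcal{L}_Q^{\mathrm{Acerbi}}:=\Bigl\{X\in\mathcal{L}^0\Bigm|\int_{(0,1)}|F_X^\leftarrow(u)|\,dQ(u)<\infty\Bigr\},\qquad \mathcal{L}_Q^{\mathrm{Pichler}}:=\Bigl\{X\in\mathcal{L}^0\Bigm|\int_{(0,1)}F_{|X|}^\leftarrow(u)\,dQ(u)<\infty\Bigr\}.$$ *)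

(* Defs.v *)
From HB Require Import structures.
From mathcomp Require Import all_boot all_order all_algebra.
From mathcomp Require Import all_classical all_reals all_analysis.
Set Implicit Arguments.
Unset Strict Implicit.
Unset Printing Implicit Defensive.
Import Order.TTheory GRing.Theory Num.Theory.
Import numFieldNormedType.Exports.
Local Open Scope classical_set_scope.
Local Open Scope ring_scope.

(* A map [0,1] -> [0,1] is a function D : R -> R of which only the values on
   [0,1] matter; right-continuity makes sense at every u < 1, including 0. *)
Record distortion (R : realType) (D : R -> R) : Prop := Distortion {
  distortion_itv : forall u : R, u \in `[0, 1] -> D u \in `[0, 1] ;
  distortion_homo : {in `[0, 1] &, {homo D : u v / u <= v}} ;
  distortion_rcont : forall u : R, u \in `[0, 1[ -> D x @[x --> u^'+] --> D u ;
  distortion0 : D 0 = 0 ;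
  distortion_sup : sup (D @` `]0, 1[%classic) = 1 }.

(* Probability measures on the Borel sets of (0,1) are represented by the Borel
   probability measures on R that give mass 1 to (0,1). *)
Record corresponds (R : realType) (D : R -> R) (Q : probability R R) : Prop :=
  Corresponds {
  corresponds_itv : Q `]0, 1[%classic = 1%E ;
  corresponds_ocitv : forall u : R, u \in `]0, 1[ ->
    Q `]0, u]%classic = (D u)%:E }.

Section quantile.
Context (d : measure_display) (T : measurableType d) (R : realType).
Variable P : probability T R.

(* Only meaningful for 0 < u < 1, where the set is nonempty and bounded below;
   inf is 0 on sets that are empty or unbounded below. *)
Definition quantile (X : {RV P >-> R}) (u : R) : R :=
  inf [set x | (u%:E <= cdf X x)%E].

Definition Lacerbi (Q : probability R R) : set {RV P >-> R} :=
  [set X | (\int[Q]_(u in `]0%R, 1%R[%classic) `|quantile X u|%:E < +oo)%E].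

Lemma measurable_absRV (X : {RV P >-> R}) :
  measurable_fun setT (fun t => `|X t|).
Proof. exact: measurableT_comp. Qed.

Definition absRV (X : {RV P >-> R}) : {RV P >-> R} :=
  mfun_Sub (mem_set (measurable_absRV X)).

Definition Lpichler (Q : probability R R) : set {RV P >-> R} :=
  [set X | (\int[Q]_(u in `]0%R, 1%R[%classic)
              (quantile (absRV X) u)%:E < +oo)%E].

End quantile.

Arguments Lacerbi {d T R} P Q.
Arguments Lpichler {d T R} P Q.

(* Main.v *)
(** For [u <= v < 1] with [u + v > 1] the events [X <= x] and [|X| <= y] overlap
    as soon as they have probabilities at least [u] and [v], so the quantile of
    [X] at [u] is bounded in absolute value by that of [|X|] at [v]. For
    [u > 1/2] take [v = u]. For small [u] a reflection is needed: cut (0,1/2]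
    into the dyadic blocks (c/2, c] and match each with (1 - c/2, 1 - c/4];
    the Acerbi integrand on the former is bounded by the Pichler integrand on
    the latter, and by convexity of [D] the latter block, half as long but
    further to the right, has at least half of the [Q]-mass of the former. *)
Require Import Defs.
From mathcomp Require Import all_boot all_order all_algebra.
From mathcomp Require Import all_classical all_reals all_analysis.
From mathcomp Require Import measurable_realfun.
From mathcomp Require Import ring lra.
Import Order.TTheory GRing.Theory Num.Theory.
Local Open Scope classical_set_scope.
Local Open Scope ring_scope.

(** The preimage of a ray [[r, +oo[] is an upper part of [i], hence an interval. *)
Lemma homo_itv_measurable (R : realType) (i : interval R) (f : R -> R) :
  {in i &, {homo f : x y / x <= y}} -> measurable_fun [set` i] f.
Proof.
move=> fi; apply: (measurability (@RGenCInfty.G R)).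
  exact: RGenCInfty.measurableE.
move=> _ [_] [r] -> <-; apply: is_interval_measurable.
move=> s t [si fs] [ti _] u /andP[su ut].
have ui : u \in i by apply: (interval_is_interval si ti); rewrite su ut.
split => //; move: fs; rewrite /= !in_itv/= !andbT => /le_trans; apply.
exact: fi.
Qed.

(** * Slopes of a convex function *)

Section convex_increments.
Context (R : realType) (D : R -> R).
Hypothesis cD : convex_function (`[0, 1]%classic : set (convex_lmodType R^o)) D.

(** Here [y] is the convex combination of [x] and [z] with weight [(z - y) / (z - x)] on [x].
    Clearing the denominators of the slopes lets points coincide. *)
Lemma convex_function_three_points (x y z : R) :
  0 <= x -> x <= y -> y <= z -> z <= 1 ->
  (D y - D x) * (z - y) <= (D z - D y) * (y - x).
Proof.
move=> x0 xy yz z1.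
have [<-|xy'] := eqVneq x y; first by rewrite !subrr mul0r mulr0.
have zx : 0 < z - x by lra.
have t0 : 0 <= (z - y) / (z - x) by apply: divr_ge0; lra.
have t1 : (z - y) / (z - x) <= 1 by rewrite ler_pdivrMr//; lra.
have := cD (Itv01 t0 t1) x z.
rewrite !inE/= !in_itv/= => /(_ _ _)/wrap[]; [lra|lra|].
rewrite convRE/= [conv _ _ _]convRE/= /unstable.onem.
set t := (z - y) / (z - x).
have tE : t * (z - x) = z - y by rewrite /t divfK// gt_eqF.
have -> : t * x + (1 - t) * z = y.
  by rewrite mulrBl mul1r; move: tE; rewrite mulrBr; lra.
move=> Dy.
have : D y * (z - x) <= (t * D x + (1 - t) * D z) * (z - x).
  by rewrite ler_wpM2r// ltW.
have -> : (t * D x + (1 - t) * D z) * (z - x) =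
  (t * (z - x)) * D x + (z - x - t * (z - x)) * D z by ring.
by rewrite tE; lra.
Qed.

(** The slope over [[x, y]] is at most that over [[y, z]], which is at most that over [[z, w]];
    [y < z] allows the middle length to be cancelled. *)
Lemma convex_function_increments (x y z w : R) :
  0 <= x -> x <= y -> y < z -> z <= w -> w <= 1 ->
  (D y - D x) * (w - z) <= (D w - D z) * (y - x).
Proof.
move=> x0 xy yz zw w1.
have xyz : (D y - D x) * (z - y) <= (D z - D y) * (y - x).
  by apply: convex_function_three_points => //; lra.
have yzw : (D z - D y) * (w - z) <= (D w - D z) * (z - y).
  by apply: convex_function_three_points => //; lra.
have zy : 0 < z - y by lra.
rewrite -(ler_pM2r zy).
have : (D y - D x) * (z - y) * (w - z) <= (D z - D y) * (y - x) * (w - z).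
  by rewrite ler_wpM2r//; lra.
have : (D z - D y) * (w - z) * (y - x) <= (D w - D z) * (z - y) * (y - x).
  by rewrite ler_wpM2r//; lra.
lra.
Qed.

End convex_increments.

Lemma corresponds_itvoc (R : realType) (D : R -> R) (Q : probability R R)
    (a b : R) :
  corresponds D Q -> 0 < a -> a <= b -> b < 1 ->
  Q `]a, b]%classic = (D b - D a)%:E.
Proof.
case=> _ DQ a0 ab b1.
have : Q `]0, b]%classic = (Q `]0%R, a]%classic + Q `]a, b]%classic)%E.
  rewrite (@itv_bndbnd_setU _ R _ (BRight a)) ?bnd_simp ?(ltW a0)//.
  rewrite measureU//; apply/seteqP; split => // x/=.
  by rewrite !in_itv/= => -[/andP[_ xa] /andP[ax _]]; lra.
rewrite !DQ ?in_itv/= ?a0 ?b1 ?(le_lt_trans ab)// ?(lt_le_trans a0)//.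
by rewrite EFinB => ->; rewrite addeAC addeC subee// adde0.
Qed.

(** * Quantiles of [X] and [|X|] *)

Section quantile_lemmas.
Context (d : measure_display) (T : measurableType d) (R : realType).
Variable P : probability T R.

Lemma cdf_quantile_nonempty (X : {RV P >-> R}) (v : R) :
  v < 1 -> [set x | (v%:E <= cdf X x)%E] !=set0.
Proof.
move=> v1; have := @cvg_cdfy1 _ _ _ P X => /(_ [set y | (v%:E < y)%E]) cdfy.
have /cdfy : nbhs (1%E : \bar R) [set y | (v%:E < y)%E].
  by apply: open_nbhs_nbhs; split => //=; exact: open_ereal_gt_ereal.
by move=> /pinfty_ex_gt0[x _ /= /ltW vx]; exists x.
Qed.

Variable X : {RV P >-> R}.

(** If [x < - y], then [X <= x] and [|X| <= y] are disjoint events, of total probability at least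
    [u + v > 1]. *)
Lemma absRV_tail_bound (u v x y : R) :
  1 < u + v -> (u%:E <= cdf X x)%E -> (v%:E <= cdf (absRV X) y)%E ->
  - y <= x.
Proof.
move=> uv ux vy; rewrite leNgt; apply/negP => xy.
have mA : measurable (X @^-1` `]-oo, x]) by exact: measurable_funPTI.
have mB : measurable (absRV X @^-1` `]-oo, y]) by exact: measurable_funPTI.
have : (P (X @^-1` `]-oo, x] `|` absRV X @^-1` `]-oo, y]) <= 1)%E.
  by apply: probability_le1; exact: measurableU.
rewrite measureU//; last first.
  apply/seteqP; split => // t/=; rewrite !in_itv/= => -[Xx].
  by rewrite ler_norml => /andP[? _]; lra.
apply/negP; rewrite -ltNge; apply: (@lt_le_trans _ _ (u%:E + v%:E)%E).
  by rewrite -EFinD lte_fin.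
exact: leeD.
Qed.

Lemma cdf_absRV_le (y : R) : (cdf (absRV X) y <= cdf X y)%E.
Proof.
rewrite /cdf /distribution /pushforward.
apply: le_measure; rewrite ?inE; do ?exact: measurable_funPTI.
by move=> t/=; rewrite !in_itv/= => /(le_trans (ler_norm _)).
Qed.

(** The level [v = 1 - u / 2] satisfies [u + v > 1], so any [y] at which the cdf of [|X|] reaches
    [v] gives the lower bound [- y]. This keeps [inf] from taking its default value 0. *)
Lemma cdf_has_lbound (u : R) :
  0 < u -> has_lbound [set x | (u%:E <= cdf X x)%E].
Proof.
move=> u0; have v1 : 1 - u / 2 < 1 by lra.
have [y vy] := cdf_quantile_nonempty (absRV X) _ v1.
by exists (- y) => x ux; apply: (absRV_tail_bound _ _ _ _ _ ux vy); lra.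
Qed.

Lemma quantile_homo (u v : R) :
  0 < u -> u <= v -> v < 1 -> quantile X u <= quantile X v.
Proof.
move=> u0 uv v1; apply: lb_le_inf; first exact: cdf_quantile_nonempty.
move=> x /= vx; apply: ge_inf; first exact: cdf_has_lbound.
by rewrite /= (le_trans _ vx)// lee_fin.
Qed.

Lemma quantile_absRV_ge0 (u : R) :
  0 < u -> u < 1 -> 0 <= quantile (absRV X) u.
Proof.
move=> u0 u1; apply: lb_le_inf; first exact: cdf_quantile_nonempty.
move=> x /= ux; rewrite leNgt; apply/negP => x0; move: ux.
rewrite /cdf /distribution /pushforward (_ : _ @^-1` _ = set0).
  by rewrite measure0 lee_fin leNgt u0.
apply/seteqP; split => // t/=; rewrite in_itv/= => /le_lt_trans/(_ x0).
by rewrite ltNge normr_ge0.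
Qed.

(** Every [y] admissible in the infimum for [|X|] at [v] gives both bounds: [- y <= quantile X u] by
    [absRV_tail_bound], and [quantile X u <= y] because [|X| <= y] implies [X <= y]. *)
Lemma normr_quantile_le (u v : R) :
  0 < u -> u <= v -> v < 1 -> 1 < u + v ->
  `|quantile X u| <= quantile (absRV X) v.
Proof.
move=> u0 uv v1 uv1; apply: lb_le_inf; first exact: cdf_quantile_nonempty.
move=> y /= vy; rewrite ler_norml; apply/andP; split.
  apply: lb_le_inf; first by apply: cdf_quantile_nonempty; lra.
  by move=> x ux; exact: (absRV_tail_bound _ _ _ _ uv1 ux vy).
apply: ge_inf; first exact: cdf_has_lbound.
by rewrite /= (le_trans _ (cdf_absRV_le y))// (le_trans _ vy).
Qed.

Lemma measurable_quantile : measurable_fun (`]0, 1[%classic : set R) (quantile X).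
Proof.
apply: homo_itv_measurable => u v; rewrite !in_itv/= => /andP[u0 _] /andP[_ v1].
by move=> uv; exact: quantile_homo.
Qed.

End quantile_lemmas.

(** * Dyadic blocks near 0 and near 1 *)

Section dyadic.
Context (R : realType).

Definition dyadic (k : nat) : R := 2^-1 ^+ k.+1.

Lemma dyadic0 : dyadic 0 = 2^-1. Proof. by rewrite /dyadic expr1. Qed.

Lemma dyadicS k : dyadic k.+1 = dyadic k / 2.
Proof. by rewrite /dyadic exprSr. Qed.

Lemma dyadic_gt0 k : 0 < dyadic k.
Proof. by rewrite exprn_gt0// invr_gt0. Qed.

Lemma dyadic_le k l : (k <= l)%N -> dyadic l <= dyadic k.
Proof.
by move=> kl; apply: ler_wiXn2l => //; rewrite ?invr_ge0// invf_le1// ler1n.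
Qed.

Lemma dyadic_le_half k : dyadic k <= 2^-1.
Proof. by rewrite -dyadic0 dyadic_le. Qed.

Definition left_block k : set R := `]dyadic k.+1, dyadic k]%classic.
(** Up to endpoints, the reflection of [left_block k.+1] under [u -> 1 - u]. The index shift puts
    the block above [1 - dyadic k.+1], so that its points and those of [left_block k] sum to more
    than 1. *)
Definition right_block k : set R := `]1 - dyadic k.+1, 1 - dyadic k.+2]%classic.

Lemma bigcup_left_block : \bigcup_k left_block k = `]0, 2^-1]%classic.
Proof.
apply/seteqP; split => [x [k _]|x]; rewrite /left_block/= !in_itv/=.
  by move=> /andP[kx xk]; have := dyadic_gt0 k.+1; have := dyadic_le_half k; lra.
move=> /andP[x0 x2].
have [n _ /(_ _ (leqnn n))/= nx] := near_infty_natSinv_expn_lt (PosNum x0).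
(* The block containing [x] is given by the least such [k]: minimality yields [x <= dyadic k], which
   for [k = 0] is the assumption [x <= 1/2]. *)
have ex : exists k, dyadic k.+1 < x.
  exists n; rewrite (le_lt_trans _ nx)// div1r -exprVn.
  by apply: ler_wiXn2l; rewrite ?invr_ge0 ?invf_le1 ?ler1n// !leqW.
case: (ex_minnP ex) => k kx kmin; exists k => //=.
rewrite /left_block/= in_itv/= kx/=.
case: k kx kmin => [_ _|k _ kmin]; first by rewrite dyadic0.
by rewrite leNgt; apply/negP => /kmin; rewrite ltnn.
Qed.

Lemma bigcup_right_block : \bigcup_k right_block k `<=` `]0, 1[.
Proof.
move=> x [k _]; rewrite /right_block/= !in_itv/= => /andP[kx xk].
by have := dyadic_gt0 k.+2; have := dyadic_le_half k.+1; lra.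
Qed.

Lemma trivIset_left_block : trivIset setT left_block.
Proof.
apply: ltn_trivIset => n m mn; apply/seteqP; split => // x [].
rewrite /left_block/= !in_itv/= => /andP[mx _] /andP[_ xn].
by have := dyadic_le _ _ mn; lra.
Qed.

Lemma trivIset_right_block : trivIset setT right_block.
Proof.
apply: ltn_trivIset => n m mn; apply/seteqP; split => // x [].
rewrite /right_block/= !in_itv/= => /andP[_ xm] /andP[nx _].
have : dyadic n.+1 <= dyadic m.+2 by exact: dyadic_le.
lra.
Qed.

(** With [c = dyadic k] the blocks have lengths [c / 2] and [c / 4], whence the factor 2. Since
    [c <= 1/2], the left block ends strictly before the right one starts. *)
Lemma left_block_le_right_block (D : R -> R) (Q : probability R R) k :
  corresponds D Q ->
  convex_function (`[0, 1]%classic : set (convex_lmodType R^o)) D ->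
  (Q (left_block k) <= 2%:E * Q (right_block k))%E.
Proof.
move=> DQ cD; have c0 := dyadic_gt0 k; have c2 := dyadic_le_half k.
rewrite /left_block /right_block !dyadicS.
do 2 (rewrite (corresponds_itvoc _ _ _ _ _ DQ); [|lra..]).
rewrite -EFinM lee_fin.
have := @convex_function_increments _ D cD (dyadic k / 2) (dyadic k)
  (1 - dyadic k / 2) (1 - dyadic k / 2 / 2).
move=> H; have {H} := H ltac:(lra) ltac:(lra) ltac:(lra) ltac:(lra) ltac:(lra).
set a := D (dyadic k) - _; set b := D (1 - _ / 2 / 2) - _ => ab.
(* The lengths are factors in [ab]; multiplying the goal by [c] makes it linear in the same
   products. *)
rewrite -(ler_pM2r c0); lra.
Qed.

End dyadic.

(** * Comparison of the two integrals *)

Theorem theorem6p2 (R : realType) (d : measure_display) (T : measurableType d)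
    (P : probability T R) (D : R -> R) (Q : probability R R) :
  distortion D -> corresponds D Q ->
  convex_function (`[0, 1]%classic : set (convex_lmodType R^o)) D ->
  Lpichler P Q `<=` Lacerbi P Q.
Proof.
move=> _ DQ cD X; rewrite /Lpichler /Lacerbi/=.
pose f (u : R) : \bar R := `|quantile X u|%:E.
pose g (u : R) : \bar R := (quantile (absRV X) u)%:E.
rewrite -/f -/g => gfin.
have mf : measurable_fun (`]0, 1[%classic : set R) f.
  by apply/measurable_EFinP; apply: measurableT_comp => //;
    exact: measurable_quantile.
have mg : measurable_fun (`]0, 1[%classic : set R) g.
  by apply/measurable_EFinP; exact: measurable_quantile.
have f0 u : (0 <= f u)%E by rewrite lee_fin.
have g0 (u : R) : u \in `]0, 1[ -> (0 <= g u)%E.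
  by rewrite in_itv/= lee_fin => /andP[]; exact: quantile_absRV_ge0.
have mL k : measurable (left_block R k) by exact: measurable_itv.
have mR k : measurable (right_block R k) by exact: measurable_itv.
have R01 k : right_block R k `<=` `]0, 1[.
  by apply: subset_trans (bigcup_right_block R); exact: bigcup_sup.
have L01 : (`]0, 2^-1]%classic : set R) `<=` `]0, 1[.
  by move=> u/=; rewrite !in_itv/=; lra.
have H01 : (`]2^-1, 1[%classic : set R) `<=` `]0, 1[.
  by move=> u/=; rewrite !in_itv/=; lra.
have block k : (\int[Q]_(u in left_block R k) f u <=
    2%:E * \int[Q]_(u in right_block R k) g u)%E.
  have c0 := dyadic_gt0 R k; have c2 := dyadic_le_half R k.
  (* The value at the left endpoint of the right block separates the integrands: it bounds [f] above
     on the left block, where [u > dyadic k.+1], and by monotonicity bounds [g] below on the right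
     block. *)
  set a := quantile (absRV X) (1 - dyadic R k.+1).
  have a0 : 0 <= a by apply: quantile_absRV_ge0; rewrite dyadicS; lra.
  apply: (@le_trans _ _ (a%:E * Q (left_block R k))%E).
    rewrite -integral_cst//; apply: ge0_le_integral => //.
    - apply: measurable_funS mf => //; apply: subset_trans L01.
      by rewrite -bigcup_left_block; exact: bigcup_sup.
    - move=> u; rewrite /left_block/= in_itv/= lee_fin => /andP[ku uk].
      by apply: normr_quantile_le; move: ku; rewrite ?dyadicS; lra.
  apply: (@le_trans _ _ (a%:E * (2%:E * Q (right_block R k)))%E).
    by rewrite lee_wpmul2l// (left_block_le_right_block _ _ _ _ DQ cD).
  rewrite muleCA lee_wpmul2l// -integral_cst//; apply: ge0_le_integral => //.
  - exact: measurable_funS mg.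
  - move=> u; rewrite /right_block/= in_itv/= lee_fin => /andP[ku uk].
    apply: quantile_homo; move: ku uk; rewrite ?dyadicS; lra.
(* The left blocks exhaust []0, 1/2]] and the right blocks are disjoint subsets of []0, 1[], so the
   block bounds add up to at most twice the Pichler integral. *)
have left_part : (\int[Q]_(u in `]0%R, 2^-1%R]) f u < +oo)%E.
  rewrite -bigcup_left_block ge0_integral_bigcup//; last 2 first.
  - by rewrite bigcup_left_block; exact: measurable_funS mf.
  - exact: trivIset_left_block.
  apply: (@le_lt_trans _ _
    (\sum_(0 <= k <oo) (2%:E * \int[Q]_(u in right_block R k) g u))%E).
    by apply: lee_nneseries => // k _ _; exact: integral_ge0.
  rewrite nneseriesZl; last first.
    by move=> k _; apply: integral_ge0 => u /R01; exact: g0.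
  rewrite -ge0_integral_bigcup//; last 3 first.
  - by apply: measurable_funS mg => //; exact: bigcup_right_block.
  - by move=> u /bigcup_right_block; exact: g0.
  - exact: trivIset_right_block.
  rewrite lte_mul_pinfty//; apply: le_lt_trans gfin.
  apply: ge0_subset_integral => //; first exact: bigcup_measurable.
  exact: bigcup_right_block.
have right_part : (\int[Q]_(u in `]2^-1%R, 1%R[) f u < +oo)%E.
  apply: (@le_lt_trans _ _ (\int[Q]_(u in `]2^-1%R, 1%R[) g u)%E).
    apply: ge0_le_integral => //; [exact: measurable_funS mf|
      exact: measurable_funS mg|].
    move=> u/=; rewrite in_itv/= lee_fin => /andP[u2 u1].
    by apply: normr_quantile_le; lra.
  by apply: le_lt_trans gfin; exact: ge0_subset_integral.
rewrite (@itv_bndbnd_setU _ R _ (BRight 2^-1)) ?bnd_simp; [|lra..].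
rewrite ge0_integral_setU//.
- exact: lte_add_pinfty.
- by apply: measurable_funS mf => // u [/L01|/H01].
- apply/disj_setPS => u/=; rewrite !in_itv/= => -[/andP[_ u2] /andP[u2' _]].
  by move: u2'; rewrite ltNge u2.
Qed.
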